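(* Let $0<p<1$ and take $q_0=p$. (i) Fix an integer $K\ge 1$ and let $(q_n)_{n\ge0}$ be the sequence of busy-link probabilities for buffer size $K$ defined in the context. Then $q_n=F(q_{n-1})$ for $n\ge 1$, where $F(q)=1-G(U(q))$, $p\le q\le 1$, and $$G(u)=\frac{u-p}{u-p\Big(\dfrac{p(1-u)}{(1-p)u}\Big)^K},\qquad U(q)=\frac{V_T(q)}{q}.$$ As $n\to\infty$, $q_n\to q^*$, where $q^*=q^*(p)$, $p<q^*<1$, is the minimal solution of the equation $q=F(q)$. (ii) For $K=\infty$, the sequence $(q_n)_{n\ge 0}$ defined in the context satisfies $q_n=p/U(q_{n-1})$ for $n\ge1$. For every $p$ such that the balance equation $V_T(q)=p$ has at least one solution $q\in[p,1]$, one has $\lim_{n\to\infty}q_n=q^*$, where $q^*=q^*(p)$ is the minimal solution of $V_T(q)=p$.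
   Context: Fix parameters $T>0$, $\mu>0$, $\sigma^2\ge 0$, $\kappa\ge 0$, $\delta>1$, $w>0$. The coverage probability function is $$V_T(q)=\int_0^\infty q\,\exp\Big\{-\frac{\mu T\sigma^2(\kappa+v^\delta)}{1+\kappa}-q\int_v^\infty\frac{wT(\kappa+v^\delta)}{\kappa+u^\delta+T(\kappa+v^\delta)}\,du\Big\}e^{-v}\,dv .$$ Busy-link probabilities: starting from $q_0=p$, for $n\ge0$ put $$U_n=\frac{V_T(q_n)}{q_n},\qquad b_n=\frac{p(1-U_n)}{(1-p)U_n},\qquad q_{n+1}=1-(1-p)\nu_0^n,$$ where, for finite $K\ge1$, $$\nu_0^n=\frac{1-b_n}{1-(p+b_n-pb_n)b_n^K}$$ (the mass at $0$ of the distribution $\nu^n_k=b_n^k\nu_0^n$ for $0\le k\le K-1$, $\nu^n_K=(1-p)b_n^K\nu^n_0$), and, for $K=\infty$, $\nu_0^n=1-b_n$ (the mass at $0$ of the geometric distribution $b_n^k(1-b_n)$, $k\ge0$). In the case $K=\infty$ the recursion is considered as long as $p<U_n$, so that $0<b_n<1$. The expressions for $\nu^n_0$ (finite $K$) at $b_n=1$ and for $G(u)$ at $u=p$ are understood by continuity, with values $1/(K+1-p)$ and $(1-p)/(K+1-p)$ respectively. *)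

(* Defs.v *)
From HB Require Import structures.
From mathcomp Require Import all_boot all_order all_algebra.
From mathcomp Require Import all_classical all_reals all_analysis.
Import Order.TTheory GRing.Theory Num.Theory.
Import numFieldNormedType.Exports.

Set Implicit Arguments.
Unset Strict Implicit.
Unset Printing Implicit Defensive.

Local Open Scope classical_set_scope.
Local Open Scope ring_scope.

(* The integrands below are nonnegative on the ranges that matter (q >= 0), so
   the Lebesgue integrals over [0, +oo[ and [v, +oo[ agree with the improper
   integrals from 0 and from v to infinity. *)
Definition interference (R : realType) (T kappa delta w v : R) : R :=
  \int[@lebesgue_measure R]_(u in `[v, +oo[)
    (w * T * (kappa + v `^ delta)
       / (kappa + u `^ delta + T * (kappa + v `^ delta))).

(* [sigma2] stands for sigma^2. *)
Definition coverage (R : realType) (T mu sigma2 kappa delta w q : R) : R :=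
  \int[@lebesgue_measure R]_(v in `[0, +oo[)
    (q * expR (- (mu * T * sigma2 * (kappa + v `^ delta) / (1 + kappa))
               - q * interference T kappa delta w v)
       * expR (- v)).

Definition load (R : realType) (p u : R) : R := p * (1 - u) / ((1 - p) * u).

(* Mass at 0 of nu_k = b^k nu_0 (0 <= k <= K-1), nu_K = (1-p) b^K nu_0; the
   case b = 1 is the value by continuity. *)
Definition nu0_fin (R : realType) (p : R) (K : nat) (b : R) : R :=
  if b == 1 then (K%:R + 1 - p)^-1
  else (1 - b) / (1 - (p + b - p * b) * b ^+ K).

(* Mass at 0 of the geometric distribution b^k (1 - b), k >= 0. *)
Definition nu0_inf (R : realType) (b : R) : R := 1 - b.

Definition success (R : realType) (V : R -> R) (q : R) : R := V q / q.

(* [nu0] maps b_n to nu_0^n. For an infinite buffer the function is total, but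
   its value at n.+1 is meaningful only when p < U_k for every k <= n. *)
Fixpoint busy (R : realType) (V : R -> R) (p : R) (nu0 : R -> R) (n : nat) : R :=
  if n is m.+1 then
    1 - (1 - p) * nu0 (load p (success V (busy V p nu0 m)))
  else p.

(* The case u = p is the value by continuity. *)
Definition Gfun (R : realType) (p : R) (K : nat) (u : R) : R :=
  if u == p then (1 - p) / (K%:R + 1 - p)
  else (u - p) / (u - p * load p u ^+ K).

Definition Ffun (R : realType) (V : R -> R) (p : R) (K : nat) (q : R) : R :=
  1 - Gfun p K (success V q).

Definition least (R : realType) (A : set R) (x : R) : Prop := A x /\ lbound A x.

(* Main.v *)
Require Import Defs.
From HB Require Import structures.
From mathcomp Require Import all_boot all_order all_algebra.
From mathcomp Require Import all_classical all_reals all_analysis.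
From mathcomp Require Import measurable_realfun exponential_distribution.
From mathcomp Require Import ring lra.

Set Implicit Arguments.
Unset Strict Implicit.
Unset Printing Implicit Defensive.

Import Order.TTheory GRing.Theory Num.Theory.
Import numFieldNormedType.Exports.

Local Open Scope classical_set_scope.
Local Open Scope ring_scope.

(** Write U(q) = V(q) / q.  Everything rests on four properties of U on
    [p, +oo[: it takes values in ]0, 1[, it is strictly decreasing, and it is
    continuous.  They come from the formula
      U(q) = int_0^oo exp (- a(v) - q I(v)) exp (- v) dv,
    where a >= 0 is the noise exponent and I(v) is the interference integral.
    The only delicate point is that I(v) is finite and positive for v > 0:
    its integrand is positive and O(u^(-delta)) with delta > 1
    ([interference_gt0]).  This makes the comparisons of integrals strict.
    Continuity comes from the inequality x exp (-x) <= 1, which gives the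
    explicit bound 0 <= U(q) - U(r) <= (r - q) / q for 0 < q <= r
    ([attenuation_lipschitz]).

    Both recursions then have the form q_{n+1} = f(q_n), q_0 = p, with f
    continuous and nondecreasing on an interval [p, r] that f maps to itself.
    Such an orbit increases and stays below every fixed point of f in [p, r],
    so its limit is a fixed point, hence the least one
    ([cvg_iter_least_fixpoint]).

    For finite K, nu_0 is the inverse of the total mass
    1 + b + ... + b^(K-1) + (1-p) b^K ([nu0_finE]).  In this form, which is
    also valid at b = 1, it is plain that nu_0 lies in ]0, 1[, decreases and
    is continuous in b.  Since b decreases in U and U in q, the map
    f = 1 - (1-p) nu_0 is nondecreasing, with values in ]p, 1[, and r = 1
    works.  The identity G(u) = (1-p) nu_0 ([GfunE]) turns f into F.

    For K = oo, f(q) = p / U(q), and V(q) = p means that q is a fixed point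
    of f.  Here r is any solution x, so that f(x) = x.  Strict monotonicity of U keeps the orbit
    strictly below x <= 1, and q_{n+1} < 1 says exactly that p < U(q_n). *)

(** * Strict comparison of integrals *)

(** A nonnegative function with zero integral vanishes almost everywhere, so [D]
    would be negligible. *)
Lemma Rintegral_gt0 d (T : measurableType d) (R : realType)
    (mu : {measure set T -> \bar R}) (D : set T) (f : T -> R) :
  measurable D -> mu D != 0%E -> mu.-integrable D (EFin \o f) ->
  (forall x, D x -> 0 < f x) -> 0 < \int[mu]_(x in D) f x.
Proof.
move=> mD muD fi f_gt0.
rewrite lt_neqAle Rintegral_ge0 ?andbT => [|x Dx]; last exact/ltW/f_gt0.
apply: contra muD => /eqP f0.
have fabs0 : (\int[mu]_(x in D) `|(f x)%:E| = 0)%E.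
  have -> : (\int[mu]_(x in D) `|(f x)%:E| = \int[mu]_(x in D) (f x)%:E)%E.
    by apply: eq_integral => x; rewrite inE => Dx;
      rewrite gee0_abs// lee_fin ltW ?f_gt0.
  have fin := integrable_fin_num mD fi.
  by rewrite -(fineK fin); move: f0; rewrite /Rintegral => <-.
apply/eqP/negligibleP => //.
have /(ae_eq_integral_abs mu mD (measurable_int mu fi)) := fabs0.
apply: negligibleS => x /= Dx /(_ Dx) [].
by apply/eqP; rewrite gt_eqF ?f_gt0.
Qed.

Lemma lt_Rintegral d (T : measurableType d) (R : realType)
    (mu : {measure set T -> \bar R}) (D : set T) (f g : T -> R) :
  measurable D -> mu D != 0%E ->
  mu.-integrable D (EFin \o f) -> mu.-integrable D (EFin \o g) ->
  (forall x, D x -> f x < g x) ->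
  \int[mu]_(x in D) f x < \int[mu]_(x in D) g x.
Proof.
move=> mD muD fi gi fg; rewrite -subr_gt0 -RintegralB//.
apply: Rintegral_gt0 => // [|x Dx]; last by rewrite subr_gt0 fg.
rewrite /comp; under eq_fun do rewrite EFinB; exact: integrableB.
Qed.

(** * The interference integral *)

Lemma powR_cvgryNy (R : realType) (r : R) : 0 < r ->
  u `^ (- r) @[u --> +oo] --> 0.
Proof.
move=> r0.
under eq_fun do rewrite powRN.
apply/gtr0_cvgV0.
  by near=> u; apply: powR_gt0; near: u; exact: nbhs_pinfty_gt.
apply/cvgryPge => A; near=> u.
apply: (le_trans (ler_norm A)).
have -> : `|A| = (`|A| `^ r^-1) `^ r by rewrite -powRrM mulVf ?gt_eqF ?powRr1.
have uA : `|A| `^ r^-1 <= u by near: u; exact: nbhs_pinfty_ge.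
by rewrite ge0_ler_powR ?nnegrE ?powR_ge0 ?(le_trans (powR_ge0 _ _) uA) ?ltW.
Unshelve. all: by end_near. Qed.

(** The primitive u^(1-d) / (1-d) vanishes at infinity as soon as d > 1. *)
Lemma integrable_powRN (R : realType) (v d : R) : 0 < v -> 1 < d ->
  (@lebesgue_measure R).-integrable `[v, +oo[ (EFin \o (fun u => u `^ (- d))).
Proof.
move=> v0 d1.
have dB1 : 1 - d != 0 by lra.
pose f (u : R) := u `^ (- d).
pose F (u : R) := (1 - d)^-1 * u `^ (1 - d).
have F' (x : R) : 0 < x -> is_derive x 1 F (f x).
  move=> x0; have := @is_derive1_powR R (1 - d) x x0.
  move=> /(@is_deriveZ _ _ _ (fun u : R => u `^ (1 - d)) (1 - d)^-1) dF.
  apply: is_derive_eq; rewrite scalerA mulVf// scale1r /f.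
  by congr (_ `^ _); ring.
have cf : {within `[v, +oo[, continuous f}.
  apply: derivable_within_continuous => x; rewrite in_itv/= andbT => vx.
  by apply: derivable_powR; rewrite in_itv/= andbT (lt_le_trans v0 vx).
have mf : measurable_fun setT f by exact: measurable_powR.
apply/integrableP; split.
  exact/measurable_EFinP/measurable_funTS.
under eq_integral do rewrite /= ger0_norm ?powR_ge0//.
rewrite (@ge0_continuous_FTC2y _ f F v 0)//.
- by rewrite -EFinB ltry.
- by move=> x _; exact: powR_ge0.
- rewrite -(mulr0 (1 - d)^-1); apply: cvgM; first exact: cvg_cst.
  by rewrite -[1 - d]opprK; apply: powR_cvgryNy; lra.
- move=> x vx; have := F' _ (lt_trans v0 vx) => ?; exact: ex_derive.
- apply: cvg_at_right_filter; apply: differentiable_continuous.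
  by have dFv := F' _ v0; exact/derivable1_diffP/ex_derive.
- move=> x; rewrite in_itv/= andbT => vx; rewrite derive1E.
  have dFx := F' _ (lt_trans v0 vx); exact: derive_val.
Qed.

Lemma lebesgue_measure_itv_bndy_neq0 (R : realType) (b : bool) (v : R) :
  @lebesgue_measure R [set` Interval (BSide b v) +oo%O] != 0%E.
Proof. by rewrite lebesgue_measure_itv/= ltry. Qed.

Section interference.
Context {R : realType} {T kappa delta w : R}.
Hypotheses (hT : 0 < T) (hkappa : 0 <= kappa) (hdelta : 1 < delta) (hw : 0 < w).
Local Notation mu := (@lebesgue_measure R).
Local Notation I := (interference T kappa delta w).
Local Notation f v u := (w * T * (kappa + v `^ delta)
       / (kappa + u `^ delta + T * (kappa + v `^ delta))).

Let f_ge0 v u : 0 <= f v u.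
Proof.
have M_ge0 x : 0 <= kappa + x `^ delta by rewrite addr_ge0 ?powR_ge0.
rewrite divr_ge0//; first by rewrite !mulr_ge0// ltW.
by rewrite addr_ge0 ?addr_ge0 ?powR_ge0// mulr_ge0// ltW.
Qed.

Lemma interference_ge0 v : 0 <= I v.
Proof. by apply: Rintegral_ge0 => u _; exact: f_ge0. Qed.

Let measurable_f : measurable_fun setT (fun z : R * R => f z.1 z.2).
Proof.
(* Inversion agrees with the power -1 on nonnegative numbers, and powers are
   measurable on the whole line. *)
have -> : (fun z : R * R => f z.1 z.2) = (fun z : R * R =>
    w * T * (kappa + z.1 `^ delta) *
    (kappa + z.2 `^ delta + T * (kappa + z.1 `^ delta)) `^ (-1)).
  apply/funext => z; rewrite powR_inv1//.
  have M_ge0 x : 0 <= kappa + x `^ delta by rewrite addr_ge0 ?powR_ge0.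
  by rewrite addr_ge0// mulr_ge0// ltW.
have mpow (h : R * R -> R) r : measurable_fun setT h ->
    measurable_fun setT (fun z => h z `^ r).
  by move=> mh; apply: (measurableT_comp (measurable_powR r) mh).
have mM : measurable_fun setT (fun z : R * R => kappa + z.1 `^ delta).
  by apply: measurable_funD => //; apply: (mpow); exact: measurable_fst.
apply: measurable_funM; first exact: measurable_funM.
apply: (mpow); apply: measurable_funD; last exact: measurable_funM.
by apply: measurable_funD => //; apply: (mpow); exact: measurable_snd.
Qed.

(** The domain [v, +oo[ depends on v.  Cutting the integrand off below the
    diagonal makes I a partial integral of one function of two variables, so
    Tonelli's theorem applies. *)
Lemma measurable_interference : measurable_fun setT I.
Proof.
pose g (z : R * R) : \bar R := if z.1 <= z.2 then (f z.1 z.2)%:E else 0%E.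
have mg : measurable_fun setT g.
  apply: measurable_fun_ifT => //.
    exact: (measurable_fun_ler measurable_fst measurable_snd).
  exact/measurable_EFinP.
have g0 z : (0 <= g z)%E by rewrite /g; case: ifP => // _; rewrite lee_fin.
have -> : I = fine \o (fun v => \int[mu]_u g (v, u))%E.
  apply/funext => v; rewrite /interference /Rintegral /= integral_mkcond.
  congr fine; apply: eq_integral => u _.
  by rewrite patchE /g /= mem_setE in_itv/= andbT.
apply: (@measurable_comp _ _ _ _ _ _ setT) => //.
exact: (@measurable_fun_fubini_tonelli_F _ _ _ _ R mu g mg g0).
Qed.

(** For u >= v > 0 the integrand is at most w T (kappa + v^delta) u^(-delta),
    hence integrable.  Without integrability I(v) would be read as 0. *)
Lemma interference_gt0 v : 0 < v -> 0 < I v.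
Proof.
move=> v0; have mf : measurable_fun setT (fun u => f v u).
  exact: (measurableT_comp measurable_f (pair1_measurable v)).
have c_gt0 : 0 < kappa + v `^ delta by rewrite ltr_wpDl ?powR_gt0.
apply: Rintegral_gt0 => //.
- exact: lebesgue_measure_itv_bndy_neq0.
- have mD : measurable (`[v, +oo[ : set (measurableTypeR R)) by [].
  have gi := integrableZl mD (w * T * (kappa + v `^ delta))
    (integrable_powRN v0 hdelta).
  apply: (le_integrable mD _ _ gi) => /=.
  + exact/measurable_EFinP/measurable_funTS.
  + move=> u; rewrite /= in_itv/= andbT => vu; have u0 := lt_le_trans v0 vu.
    rewrite lee_fin !ger0_norm//; last first.
      by rewrite mulr_ge0 ?powR_ge0 ?mulr_ge0 ?ltW.
    rewrite powRN; apply: ler_wpM2l; first by rewrite !mulr_ge0// ltW.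
    rewrite lef_pV2 ?posrE ?powR_gt0//.
      by rewrite -addrA addrCA lerDl addr_ge0// mulr_ge0 ?ltW.
    by rewrite ltr_wpDl ?mulr_gt0// addr_ge0 ?powR_ge0.
- move=> u _; rewrite mulr_gt0 ?mulr_gt0 ?invr_gt0//.
  by rewrite ltr_wpDl ?mulr_gt0// addr_ge0 ?powR_ge0.
Qed.

End interference.

(** * Success probability as a function of the busy-link probability *)

Lemma integrable_expRN (R : realType) :
  (@lebesgue_measure R).-integrable `]0, +oo[ (EFin \o (fun v => expR (- v))).
Proof.
have mD : measurable (`]0, +oo[ : set (measurableTypeR R)) by [].
have := integrableS measurableT mD (@subsetT _ _)
  (integrable_exponential_pdf ltr01).
apply: eq_integrable => // v; rewrite inE/= in_itv/= andbT => v0.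
by rewrite exponential_pdfE ?ltW// mul1r mulN1r.
Qed.

Lemma Rintegral_expRN (R : realType) :
  \int[@lebesgue_measure R]_(v in `]0, +oo[) expR (- v) = 1.
Proof.
rewrite Rintegral_itv_obnd_cbnd; last exact: integrable_expRN.
rewrite /Rintegral -[RHS]/(fine 1%E) -(@integral_exponential_pdf R 1 ltr01).
rewrite integral_mkcond; congr fine; apply: eq_integral => v _.
rewrite /exponential_pdf !patchE; case: ifPn => // _.
by rewrite mul1r mulN1r.
Qed.

Section attenuation.
Context {R : realType} (a I : R -> R).
Hypotheses (ma : measurable_fun setT a) (mI : measurable_fun setT I).
Hypotheses (a_ge0 : forall v, 0 <= a v) (I_ge0 : forall v, 0 <= I v).
Hypothesis I_gt0 : forall v, 0 < v -> 0 < I v.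
Local Notation mu := (@lebesgue_measure R).
Local Notation D := ([set` `]0, +oo[%R] : set (measurableTypeR R)).

(** [success] of [coverage], for a general noise exponent [a] and interference
    [I].  The point v = 0 is left out because I(0) need not be positive: when
    kappa = 0 the integrand of I(0) is zero. *)
Definition attenuation (q : R) : R :=
  \int[mu]_(v in `]0, +oo[) (expR (- a v - q * I v) * expR (- v)).

Let mD : measurable D. Proof. by []. Qed.
Let muD : mu D != 0%E. Proof. exact: lebesgue_measure_itv_bndy_neq0. Qed.

Lemma integrable_attenuation q : 0 <= q ->
  mu.-integrable `]0, +oo[
    (EFin \o (fun v => expR (- a v - q * I v) * expR (- v))).
Proof.
move=> q0; apply: (le_integrable mD _ _ (integrable_expRN R)) => /=.
  apply/measurable_EFinP/measurable_funTS; apply: measurable_funM.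
    apply: measurableT_comp => //; apply: measurable_funB.
      exact: measurableT_comp.
    exact: measurable_funM.
  exact: measurableT_comp.
move=> v _; rewrite lee_fin !ger0_norm ?mulr_ge0 ?expR_ge0//.
rewrite ler_piMl ?expR_ge0// -expR0 ler_expR.
by have := a_ge0 v; have := mulr_ge0 q0 (I_ge0 v); lra.
Qed.

Lemma attenuation_gt0 q : 0 <= q -> 0 < attenuation q.
Proof.
move=> q0; apply: Rintegral_gt0 => //; first exact: integrable_attenuation.
by move=> v _; rewrite mulr_gt0 ?expR_gt0.
Qed.

Lemma attenuation_lt1 q : 0 < q -> attenuation q < 1.
Proof.
move=> q0; rewrite -(Rintegral_expRN R).
apply: lt_Rintegral => //; first exact/integrable_attenuation/ltW.
  exact: integrable_expRN.
move=> v; rewrite /= in_itv/= andbT => v0.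
rewrite gtr_pMl ?expR_gt0// -expR0 ltr_expR.
by have := a_ge0 v; have := mulr_gt0 q0 (I_gt0 v0); lra.
Qed.

Lemma attenuation_decr q r : 0 <= q -> q < r -> attenuation r < attenuation q.
Proof.
move=> q0 qr; apply: lt_Rintegral => //.
- by apply: integrable_attenuation; rewrite ltW// (le_lt_trans q0).
- exact: integrable_attenuation.
move=> v; rewrite /= in_itv/= andbT => v0.
by rewrite ltr_pM2r ?expR_gt0// ltr_expR ltrD2l ltrN2 ltr_pM2r ?I_gt0.
Qed.

(** For q <= r, exp (-qI) - exp (-rI) = exp (-qI) (1 - exp (-(r-q)I)) is at most
    (r-q) I exp (-qI) = ((r-q)/q) (qI) exp (-qI), and x exp (-x) <= 1. *)
Lemma attenuation_lipschitz q r : 0 < q -> q <= r ->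
  attenuation q - attenuation r <= (r - q) / q.
Proof.
move=> q0 qr; have q0' := ltW q0; have r0 := le_trans q0' qr.
rewrite -RintegralB//; [|exact: integrable_attenuation..].
rewrite -[leRHS]mulr1 -(Rintegral_expRN R) -RintegralZl//; last first.
  exact: integrable_expRN.
apply: le_Rintegral => //.
- have := integrableB mD (integrable_attenuation q0')
    (integrable_attenuation r0).
  by apply: eq_integrable.
- have := integrableZl mD ((r - q) / q) (integrable_expRN R).
  by apply: eq_integrable.
move=> v _; rewrite -mulrBl ler_wpM2r ?expR_ge0//.
have dI : expR (- a v - r * I v) =
    expR (- a v - q * I v) * expR (- ((r - q) * I v)).
  by rewrite -expRD; congr expR; ring.
have e1 := expR_ge1Dx (- ((r - q) * I v)).
have e2 := expR_ge1Dx (q * I v).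
have qI := mulr_ge0 q0' (I_ge0 v).
have E : expR (- a v - q * I v) * (1 + q * I v) <= 1.
  apply: (@le_trans _ _ (expR (- a v - q * I v) * expR (q * I v))).
    by rewrite ler_wpM2l ?expR_ge0.
  by rewrite -expRD subrK -expR0 ler_expR oppr_le0.
have e0 := expR_gt0 (- a v - q * I v).
rewrite dI; set e := expR _ in e0 E *.
apply: (@le_trans _ _ (e * ((r - q) * I v))).
  by rewrite -{1}[e]mulr1 -mulrBr; apply: ler_wpM2l; [exact: ltW|lra].
have -> : e * ((r - q) * I v) = (r - q) * (e * (q * I v)) / q.
  by rewrite mulrCA -mulrA; congr (_ * _); field; rewrite gt_eqF.
rewrite ler_pM2r ?invr_gt0//; apply: ler_piMr; first by rewrite subr_ge0.
nra.
Qed.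

Lemma attenuation_cvg (p : R) (q : nat -> R) (l : R) : 0 < p ->
  (forall n, p <= q n) -> p <= l -> q n @[n --> \oo] --> l ->
  attenuation (q n) @[n --> \oo] --> attenuation l.
Proof.
move=> p0 pq pl ql.
have half r s : p <= r -> r <= s ->
    `|attenuation r - attenuation s| <= `|r - s| / p.
  move=> pr rs; have r0 := lt_le_trans p0 pr.
  rewrite ger0_norm ?subr_ge0; last first.
    have [->//|rs'] := eqVneq r s.
    by rewrite ltW// attenuation_decr ?(ltW r0)// lt_neqAle rs'.
  apply: (le_trans (attenuation_lipschitz r0 rs)).
  by rewrite distrC ger0_norm ?subr_ge0// ler_wpM2l ?subr_ge0// lef_pV2.
have lip r s : p <= r -> p <= s ->
    `|attenuation r - attenuation s| <= `|r - s| / p.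
  move=> pr ps; have [rs|/ltW sr] := leP r s; first exact: half.
  by rewrite distrC [leRHS](_ : _ = `|s - r| / p) ?half// distrC.
apply/cvgrPdist_le => e e0; near=> n.
apply: (le_trans (lip _ _ pl (pq n))); rewrite ler_pdivrMr//.
by near: n; move/cvgrPdist_le : ql; apply; rewrite mulr_gt0.
Unshelve. all: by end_near. Qed.

End attenuation.

Section coverage.
Context {R : realType} {T mu sigma2 kappa delta w : R}.
Hypotheses (hT : 0 < T) (hmu : 0 < mu) (hsigma2 : 0 <= sigma2)
  (hkappa : 0 <= kappa).
Hypothesis mI : measurable_fun setT (interference T kappa delta w).
Hypothesis I_ge0 : forall v, 0 <= interference T kappa delta w v.

Definition noise (v : R) : R :=
  mu * T * sigma2 * (kappa + v `^ delta) / (1 + kappa).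

Lemma noise_ge0 v : 0 <= noise v.
Proof.
by rewrite divr_ge0 ?addr_ge0// mulr_ge0 ?addr_ge0 ?powR_ge0// !mulr_ge0// ltW.
Qed.

Lemma measurable_noise : measurable_fun setT noise.
Proof.
by apply: measurable_funM => //; apply: measurable_funM => //;
  apply: measurable_funD.
Qed.

Lemma success_coverage q : 0 < q ->
  success (coverage T mu sigma2 kappa delta w) q =
  attenuation noise (interference T kappa delta w) q.
Proof.
move=> q0; have i :=
  integrable_attenuation measurable_noise mI noise_ge0 I_ge0 (ltW q0).
have mD : measurable (`]0, +oo[ : set (measurableTypeR R)) by [].
rewrite /success /coverage -Rintegral_itv_obnd_cbnd; last first.
  have := integrableZl mD q i; apply: eq_integrable => // v _.
  by rewrite /= -EFinM mulrA.
under eq_Rintegral do rewrite -mulrA.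
by rewrite RintegralZl// mulrAC divff ?gt_eqF// mul1r.
Qed.

End coverage.

(** * The stationary mass at zero and the load *)

(** The denominator is the total mass of the measure with weights b^k for k < K
    and (1-p) b^K at K.  This form has no singularity at b = 1, so it yields
    positivity, monotonicity and continuity uniformly in b. *)
Lemma nu0_finE (R : realType) (p b : R) (K : nat) :
  nu0_fin p K b = (\sum_(i < K) b ^+ i + (1 - p) * b ^+ K)^-1.
Proof.
rewrite /nu0_fin; have [->|b1] := eqVneq b 1.
  under eq_bigr do rewrite expr1n.
  by rewrite sumr_const card_ord expr1n mulr1 addrA.
have b1' : 1 - b != 0 by rewrite subr_eq0 eq_sym.
have -> : 1 - (p + b - p * b) * b ^+ K =
    (1 - b) * (\sum_(i < K) b ^+ i + (1 - p) * b ^+ K).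
  have geom : (1 - b) * (\sum_(i < K) b ^+ i) = 1 - b ^+ K.
    by rewrite -(opprB b 1) mulNr -subrX1 opprB.
  by rewrite mulrDr geom; ring.
by rewrite invfM mulrA divff// mul1r.
Qed.

Lemma nu_weight_gt0 (R : realType) (p b : R) (K : nat) : p < 1 -> 0 <= b ->
  0 < \sum_(i < K) b ^+ i + (1 - p) * b ^+ K.
Proof.
move=> p1 b0; have p1' : 0 < 1 - p by rewrite subr_gt0.
case: K => [|K]; first by rewrite big_ord0 expr0 mulr1 add0r.
rewrite big_ord_recl expr0 -addrA ltr_pwDl// addr_ge0//.
  by apply: sumr_ge0 => i _; exact: exprn_ge0.
by rewrite mulr_ge0 ?exprn_ge0// ltW.
Qed.

Lemma nu0_fin_gt0 (R : realType) (p b : R) (K : nat) : p < 1 -> 0 <= b ->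
  0 < nu0_fin p K b.
Proof. by move=> p1 b0; rewrite nu0_finE invr_gt0 nu_weight_gt0. Qed.

Lemma nu0_fin_lt1 (R : realType) (p b : R) (K : nat) : (1 <= K)%N ->
  p < 1 -> 0 < b -> nu0_fin p K b < 1.
Proof.
move=> K1 p1 b0; rewrite nu0_finE invf_lt1 ?nu_weight_gt0 ?ltW//.
case: K K1 => // K _; rewrite big_ord_recl expr0 -addrA ltrDl.
apply: ltr_wpDl; last by rewrite mulr_gt0 ?subr_gt0 ?exprn_gt0.
by apply: sumr_ge0 => i _; rewrite exprn_ge0// ltW.
Qed.

Lemma nu0_fin_anti (R : realType) (p b c : R) (K : nat) : p < 1 ->
  0 <= b -> b <= c -> nu0_fin p K c <= nu0_fin p K b.
Proof.
move=> p1 b0 bc; have c0 := le_trans b0 bc.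
rewrite !nu0_finE lef_pV2 ?posrE ?nu_weight_gt0//; apply: lerD.
  by apply: ler_sum => i _; apply: lerXn2r.
by apply: ler_wpM2l; [rewrite subr_ge0 ltW|exact: lerXn2r].
Qed.

Lemma cvg_nu0_fin (R : realType) (p l : R) (K : nat) (b : nat -> R) : p < 1 ->
  (forall n, 0 <= b n) -> 0 <= l -> b n @[n --> \oo] --> l ->
  nu0_fin p K (b n) @[n --> \oo] --> nu0_fin p K l.
Proof.
move=> p1 b0 l0 bl; rewrite nu0_finE.
under eq_fun do rewrite nu0_finE.
have cvgX k : b n ^+ k @[n --> \oo] --> l ^+ k.
  elim: k => [|k IHk]; first by rewrite expr0; exact: cvg_cst.
  under eq_fun do rewrite exprS.
  by rewrite exprS; exact: cvgM.
have cvgS k : \sum_(i < k) b n ^+ i @[n --> \oo] --> \sum_(i < k) l ^+ i.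
  elim: k => [|k IHk].
    by under eq_fun do rewrite big_ord0; rewrite big_ord0; exact: cvg_cst.
  under eq_fun do rewrite big_ord_recr/=.
  by rewrite big_ord_recr/=; exact: cvgD.
apply: cvgV; first by rewrite gt_eqF ?nu_weight_gt0.
by apply: cvgD => //; apply: cvgM => //; exact: cvg_cst.
Qed.

(** In this form the load is visibly decreasing and continuous in u. *)
Lemma loadE (R : realType) (p u : R) : u != 0 ->
  load p u = p / (1 - p) * (u^-1 - 1).
Proof.
move=> u0; rewrite /load invfM mulrACA; congr (_ * _).
by rewrite mulrBl mul1r divff.
Qed.

Lemma load_gt0 (R : realType) (p u : R) : 0 < p -> p < 1 -> 0 < u -> u < 1 ->
  0 < load p u.
Proof. by move=> *; rewrite /load divr_gt0 ?mulr_gt0 ?subr_gt0. Qed.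

Lemma load_anti (R : realType) (p u v : R) : 0 < p -> p < 1 -> 0 < u -> u <= v ->
  load p v <= load p u.
Proof.
move=> p0 p1 u0 uv; have v0 := lt_le_trans u0 uv.
rewrite !loadE ?gt_eqF//; apply: ler_wpM2l.
  by rewrite divr_ge0 ?subr_ge0// ltW.
by rewrite lerD2r lef_pV2.
Qed.

Lemma cvg_load (R : realType) (p l : R) (u : nat -> R) : 0 < l ->
  (forall n, 0 < u n) -> u n @[n --> \oo] --> l ->
  load p (u n) @[n --> \oo] --> load p l.
Proof.
move=> l0 u0 ul; rewrite loadE ?gt_eqF//.
under eq_fun do rewrite loadE ?gt_eqF//.
apply: cvgM; first exact: cvg_cst.
by apply: cvgB; [apply: cvgV; rewrite ?gt_eqF|exact: cvg_cst].
Qed.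

(** With b = load p u one has 1 - b = (u - p) / ((1-p) u) and
    p + b - p b = p / u; and b = 1 exactly when u = p, so the two conventions by
    continuity match. *)
Lemma GfunE (R : realType) (p u : R) (K : nat) : 0 < p -> p < 1 -> u != 0 ->
  Gfun p K u = (1 - p) * nu0_fin p K (load p u).
Proof.
move=> p0 p1 u0; have p1' : 1 - p != 0 by rewrite gt_eqF ?subr_gt0.
rewrite /Gfun /nu0_fin; have [->|up] := eqVneq u p.
  by rewrite /load [_ * p]mulrC divff ?eqxx// mulf_neq0// gt_eqF.
have -> : (load p u == 1) = false.
  apply/negbTE; apply: contra up => /eqP.
  move=> /(congr1 ( *%R ^~ ((1 - p) * u))).
  rewrite /load divfK ?mulf_neq0// mul1r => e; apply/eqP.
  by have : p * (1 - u) - (1 - p) * u = 0; [rewrite e subrr|lra].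
have -> : p + load p u - p * load p u = p / u.
  by rewrite /load; field; rewrite p1' u0.
have -> : 1 - p / u * load p u ^+ K = (u - p * load p u ^+ K) / u.
  by field.
(* Both sides now carry the same inverse of u - p b^K. *)
rewrite invf_div mulrA mulrA; congr (_ / _).
by rewrite /load; field; rewrite p1' u0.
Qed.

(** * Iterating a monotone map from the left end of an interval *)

(** Monotonicity carries two inequalities along the orbit: u_n <= u_(n+1),
    starting from a <= f a, and u_n <= y for each fixed point y, starting from
    a <= y.  Continuity makes the limit a fixed point.  Continuity is
    phrased with sequences inside [a, b] because a two-sided limit at an end of
    the interval would involve values of f outside it. *)
Lemma cvg_iter_least_fixpoint (R : realType) (f : R -> R) (a b : R) (u : nat -> R) :
  a <= b ->
  {in `[a, b] &, {homo f : s t / s <= t}} ->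
  a <= f a -> f b <= b ->
  (forall (x : nat -> R) (l : R), (forall n, x n \in `[a, b]) -> l \in `[a, b] ->
     x n @[n --> \oo] --> l -> f (x n) @[n --> \oo] --> f l) ->
  u 0%N = a -> (forall n, u n.+1 = f (u n)) ->
  (forall n, u n \in `[a, b]) /\
  exists l, least [set x | a <= x <= b /\ x = f x] l /\ u n @[n --> \oo] --> l.
Proof.
move=> ab fhomo afa fbb fcont u0 uS.
have aI : a \in `[a, b] by rewrite in_itv/= lexx.
have bI : b \in `[a, b] by rewrite in_itv/= lexx ab.
have uI n : u n \in `[a, b].
  elim: n => [|n IHn]; first by rewrite u0.
  rewrite uS in_itv/=; apply/andP; split.
    by apply: (le_trans afa); apply: fhomo => //; rewrite (itvP IHn).
  by apply: le_trans fbb; apply: fhomo => //; rewrite (itvP IHn).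
have und : nondecreasing_seq u.
  apply/nondecreasing_seqP; elim=> [|n IHn]; first by rewrite uS u0.
  by rewrite 2!uS fhomo.
have below y : y \in `[a, b] -> f y = y -> forall n, u n <= y.
  move=> yI fy; elim=> [|n IHn]; first by rewrite u0 (itvP yI).
  by rewrite uS -fy fhomo.
have ucvg : u n @[n --> \oo] --> sup (range u).
  apply: nondecreasing_cvgn => //.
  by exists b => _ [n _ <-]; rewrite (itvP (uI n)).
split=> //; exists (sup (range u)); split=> //.
have lub y : (forall n, u n <= y) -> sup (range u) <= y.
  move=> uy; apply: ge_sup; first by exists (u 0%N), 0%N.
  by move=> _ [n _ <-].
have lI : sup (range u) \in `[a, b].
  rewrite in_itv/= (lub b) ?andbT => [|n]; last by rewrite (itvP (uI n)).
  rewrite -{1}u0; apply: ub_le_sup; last by exists 0%N.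
  by exists b => _ [n _ <-]; rewrite (itvP (uI n)).
split.
  split; first by rewrite !(itvP lI).
  have := fcont _ _ uI lI ucvg.
  under eq_fun do rewrite -uS.
  move=> fu; have u'cvg : u n.+1 @[n --> \oo] --> sup (range u).
    by rewrite (cvg_shiftS u).
  exact: (cvg_unique _ u'cvg fu).
move=> y [yab yfy]; apply: lub; apply: below => //.
Qed.

(** * The busy-link recursions *)

Section busy_link.
Context {R : realType} (V : R -> R) (p : R).
Hypotheses (p0 : 0 < p) (p1 : p < 1).
Local Notation U := (success V).
Hypothesis U_gt0 : forall q, p <= q -> 0 < U q.
Hypothesis U_lt1 : forall q, p <= q -> U q < 1.
Hypothesis U_decr : forall q r, p <= q -> q < r -> U r < U q.
Hypothesis U_cvg : forall (q : nat -> R) l, (forall n, p <= q n) -> p <= l ->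
  q n @[n --> \oo] --> l -> U (q n) @[n --> \oo] --> U l.

Let U_anti q r : p <= q -> q <= r -> U r <= U q.
Proof. by move=> pq; rewrite le_eqVlt => /predU1P[->|/(U_decr pq)/ltW]. Qed.

Let load_ge0 q : p <= q -> 0 <= load p (U q).
Proof. by move=> pq; rewrite ltW// load_gt0 ?U_gt0 ?U_lt1. Qed.

Lemma busy_fin (K : nat) : (1 <= K)%N ->
  let q := busy V p (nu0_fin p K) in
  let F := Ffun V p K in
  (forall n : nat, p <= q n <= 1) /\
  (forall n : nat, q n.+1 = F (q n)) /\
  exists qs : R,
    p < qs < 1 /\
    least [set x | p <= x <= 1 /\ x = F x] qs /\
    q n @[n --> \oo] --> qs.
Proof.
move=> K1 q F.
have p1' : 0 < 1 - p by rewrite subr_gt0.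
pose f x := 1 - (1 - p) * nu0_fin p K (load p (U x)).
have Ff x : p <= x -> F x = f x.
  by move=> px; rewrite /F /Ffun GfunE// gt_eqF ?U_gt0.
have f_gtp x : p <= x -> p < f x.
  move=> px; have b0 : 0 < load p (U x) by rewrite load_gt0 ?U_gt0 ?U_lt1.
  by have := nu0_fin_lt1 K1 p1 b0; rewrite /f; nra.
have f_lt1 x : p <= x -> f x < 1.
  move=> px; rewrite /f gtrBl mulr_gt0//.
  by rewrite nu0_fin_gt0 ?load_ge0.
have [|||||||qI [l [[[lI lf] lmin] ql]]] :=
    @cvg_iter_least_fixpoint R f p 1 q.
- exact: ltW.
- move=> x y; rewrite !in_itv/= => /andP[px _] /andP[py _] xy.
  rewrite /f lerD2l lerN2 ler_pM2l// nu0_fin_anti ?load_ge0//.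
  by rewrite load_anti ?U_gt0 ?U_anti.
- exact/ltW/f_gtp.
- exact/ltW/f_lt1/ltW.
- move=> x y xI; rewrite in_itv/= => /andP[py _] xy.
  have px n : p <= x n by rewrite (itvP (xI n)).
  rewrite /f; apply: cvgB; first exact: cvg_cst.
  apply: cvgM; first exact: cvg_cst.
  apply: cvg_nu0_fin => //; [by move=> n; exact: load_ge0|exact: load_ge0|].
  by apply: cvg_load; [exact: U_gt0|by move=> n; exact: U_gt0|exact: U_cvg].
- by [].
- by [].
have qp n : p <= q n by rewrite (itvP (qI n)).
split; first by move=> n; rewrite !(itvP (qI n)).
split; first by move=> n; rewrite Ff.
have pl : p <= l by case/andP: lI.
exists l; split; first by rewrite lf f_gtp ?f_lt1.
split=> //; split; first by split; rewrite ?Ff.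
move=> y [yI yF]; apply: lmin; split=> //.
by rewrite -Ff//; case/andP: yI.
Qed.

Lemma busy_infS n : U (busy V p (@nu0_inf R) n) != 0 ->
  busy V p (@nu0_inf R) n.+1 = p / U (busy V p (@nu0_inf R) n).
Proof.
move=> U0; have p1' : 1 - p != 0 by rewrite gt_eqF ?subr_gt0.
by rewrite /= /nu0_inf /load; field; rewrite U0.
Qed.

(** The interval of the fixed-point lemma ends at an arbitrary solution x, since
    nothing prevents p / U from exceeding 1 beyond x.  The least fixed point in
    [p, x] is the least solution in [p, 1], because x is itself a solution. *)
Lemma busy_inf : let q := busy V p (@nu0_inf R) in
  (exists x : R, p <= x <= 1 /\ V x = p) ->
  (forall n : nat, p < U (q n)) /\
  exists qs : R,
    least [set x | p <= x <= 1 /\ V x = p] qs /\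
    q n @[n --> \oo] --> qs.
Proof.
move=> q [x [/andP[px x1] Vx]].
have VE y : p <= y -> V y = p <-> y = p / U y.
  move=> py; have y0 := lt_le_trans p0 py; have Uy0 := U_gt0 py.
  have -> : V y = y * U y by rewrite /success mulrC divfK ?gt_eqF.
  by split=> [<-|{1}->]; rewrite ?mulfK ?divfK ?gt_eqF.
have xE : x = p / U x by apply/VE.
have p_lt y : p <= y -> p < p / U y.
  by move=> py; rewrite ltr_pdivlMr ?U_gt0// gtr_pMr ?U_lt1.
pose f y := p / U y.
have qS n : p <= q n -> q n.+1 = f (q n).
  by move=> pq; apply: busy_infS; rewrite gt_eqF ?U_gt0.
have qx n : p <= q n < x.
  elim: n => [|n /andP[pq qx]]; first by rewrite lexx {1}xE p_lt.
  rewrite qS//.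
  rewrite ltW ?p_lt// {1}xE /f ltr_pM2l// ltf_pV2 ?posrE ?U_gt0//.
  exact: U_decr.
have qp n : p <= q n by case/andP: (qx n).
split=> [n|].
  (* q_{n+1} = p / U(q_n) < x <= 1 *)
  have /andP[_] := qx n.+1; rewrite qS//.
  move=> fx; have := lt_le_trans fx x1.
  by rewrite /f ltr_pdivrMr ?U_gt0// mul1r.
have [|||||||_ [l [[[lI lf] lmin] ql]]] :=
    @cvg_iter_least_fixpoint R f p x q.
- by [].
- move=> y z; rewrite !in_itv/= => /andP[py _] /andP[pz _] yz.
  by rewrite /f ler_pM2l// lef_pV2 ?posrE ?U_gt0 ?U_anti.
- exact/ltW/p_lt.
- by rewrite /f -xE.
- move=> y z yI; rewrite in_itv/= => /andP[pz _] yz.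
  rewrite /f; apply: cvgM; first exact: cvg_cst.
  apply: cvgV; first by rewrite gt_eqF ?U_gt0.
  by apply: U_cvg => // n; rewrite (itvP (yI n)).
- by [].
- by move=> n; rewrite qS.
have /andP[pl lx] := lI.
exists l; split=> //; split.
  by split; [rewrite pl (le_trans lx)|apply/VE].
move=> y [/andP[py y1] Vy]; have [yx|/ltW xy] := leP y x.
  by apply: lmin; split; [rewrite py|apply/VE].
exact: le_trans xy.
Qed.

End busy_link.

Theorem lemma4 (R : realType) (T mu sigma2 kappa delta w p : R)
    (hT : 0 < T) (hmu : 0 < mu) (hsigma2 : 0 <= sigma2) (hkappa : 0 <= kappa)
    (hdelta : 1 < delta) (hw : 0 < w) (hp0 : 0 < p) (hp1 : p < 1) :
  let V := coverage T mu sigma2 kappa delta w in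
  let U := success V in
  (forall K : nat, (1 <= K)%N ->
     let q := busy V p (nu0_fin p K) in
     let F := Ffun V p K in
     (forall n : nat, p <= q n <= 1) /\
     (forall n : nat, q n.+1 = F (q n)) /\
     exists qs : R,
       p < qs < 1 /\
       least [set x | p <= x <= 1 /\ x = F x] qs /\
       q n @[n --> \oo] --> qs)
  /\
  (let q := busy V p (@nu0_inf R) in
   (forall n : nat, (forall k : nat, (k <= n)%N -> p < U (q k)) ->
      q n.+1 = p / U (q n)) /\
   ((exists x : R, p <= x <= 1 /\ V x = p) ->
      (forall n : nat, p < U (q n)) /\
      exists qs : R,
        least [set x | p <= x <= 1 /\ V x = p] qs /\
        q n @[n --> \oo] --> qs)).
Proof.
move=> V U.
have mI := measurable_interference hT hkappa hw (delta := delta).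
have I_ge0 := interference_ge0 hT hkappa hw (delta := delta).
have I_gt0 := interference_gt0 hT hkappa hdelta hw.
have mN := measurable_noise (T := T) (mu := mu) (sigma2 := sigma2)
  (kappa := kappa) (delta := delta).
have N_ge0 := noise_ge0 hT hmu hsigma2 hkappa (delta := delta).
have UE q : p <= q -> U q = attenuation _ _ q :=
  fun pq => success_coverage hT hmu hsigma2 hkappa mI I_ge0 (lt_le_trans hp0 pq).
have gt0 q : p <= q -> 0 < q by exact: lt_le_trans.
have U_gt0 q : p <= q -> 0 < U q.
  by move=> pq; rewrite UE// attenuation_gt0 ?ltW ?gt0.
have U_lt1 q : p <= q -> U q < 1.
  by move=> pq; rewrite UE// attenuation_lt1 ?gt0.
have U_decr q r : p <= q -> q < r -> U r < U q.
  move=> pq qr; rewrite !UE ?(le_trans pq (ltW qr))//.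
  by rewrite attenuation_decr ?ltW ?gt0.
have U_cvg (q : nat -> R) l : (forall n, p <= q n) -> p <= l ->
    q n @[n --> \oo] --> l -> U (q n) @[n --> \oo] --> U l.
  move=> pq pl ql; rewrite UE//; under eq_fun do rewrite UE//.
  exact: (attenuation_cvg mN mI N_ge0 I_ge0 I_gt0 hp0).
split; first by move=> K K1; exact: busy_fin.
split; last exact: busy_inf.
move=> n pU; apply: busy_infS => //.
by rewrite gt_eqF// (lt_trans hp0)// pU.
Qed.
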